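(* Let $\{V_{m,j}\}$ be the $[0,1]$-valued random variables driving a quantile pyramid, with associated level-$m$ functions $Q_m$, derivatives $q_m$, and limit $Q$. Assume that all the $V_{m,j}$ ($m\ge1$, $j\in\{1,3,\dots,2^m-1\}$) are independent, and write $\mathrm E V_{m,j}=\tfrac12+\delta_{m,j}$ and $\mathrm{Var}\,V_{m,j}=\sigma_{m,j}^2$. Assume further that $|\delta_{m,j}|\le\delta_m$ and $\sigma_{m,j}\le\sigma_m$ for all $j$ at level $m$, where $\sum_{m=1}^\infty\sigma_m^2$ and $\sum_{m=1}^\infty\delta_m$ are both finite. Then with probability $1$ there is a function $q(y)$ on $[0,1]$ which is the almost everywhere (in $y$) limit of $q_m(y)$ as $m\to\infty$, and $Q$ is the integral of $q$, that is, $Q(y)=\int_0^y q(u)\,du$ for all $0\le y\le1$.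
   Context: Quantile pyramid: for each $m\ge1$ and $j\in\{1,3,5,\dots,2^m-1\}$ let $V_{m,j}$ be a $[0,1]$-valued random variable. Recursively, at level $m$, $Q_m$ agrees with $Q_{m-1}$ at the points $i/2^{m-1}$, $0\le i\le 2^{m-1}$ (for $m=1$ the level-$0$ function is taken to be the identity, so $Q_1(0)=0$, $Q_1(1)=1$), and for odd $j$ $$Q_m(j/2^m)=Q_{m-1}((j-1)/2^m)(1-V_{m,j})+Q_{m-1}((j+1)/2^m)V_{m,j}.$$ $Q_m$ is extended to all of $[0,1]$ by linear interpolation between the points $j/2^m$, $0\le j\le 2^m$. Its derivative, defined outside the points $j/2^m$, is $$q_m(y)=\{Q_m(j/2^m)-Q_m((j-1)/2^m)\}/(\tfrac12)^m\quad\text{for } y\in((j-1)/2^m,j/2^m).$$ $Q$ denotes the limiting quantile process, $Q(y)=\lim_{m\to\infty}Q_m(y)$ (at a dyadic point $y=j/2^m$ it equals $Q_m(j/2^m)$, since this value does not change at later levels). *)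

(* Defs.v *)
From HB Require Import structures.
From mathcomp Require Import all_boot all_order all_algebra.
From mathcomp Require Import all_classical all_reals all_analysis.

Set Implicit Arguments.
Unset Strict Implicit.
Unset Printing Implicit Defensive.

Import Order.TTheory GRing.Theory Num.Theory.
Import numFieldNormedType.Exports.

Local Open Scope classical_set_scope.
Local Open Scope ring_scope.

Definition mutually_independent d (T : measurableType d) (R : realType)
    (P : probability T R) (I : choiceType) (D : set I) (X : I -> T -> R) : Prop :=
  forall (s : seq I) (A : I -> set R),
    uniq s -> [set` s] `<=` D -> (forall i, measurable (A i)) ->
    P (\bigcap_(i in [set` s]) (X i @^-1` A i)) =
      (\prod_(i <- s) P (X i @^-1` A i))%E.

(* The pairs (m, j) that index the variables V_{m,j} of the pyramid. *)
Definition pyramid_index (m j : nat) : bool :=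
  [&& (0 < m)%N, odd j & (j < 2 ^ m)%N].

(* [Qgrid v m j] is Q_m(j / 2^m), for j <= 2^m.  For even j this is
   Q_{m-1}((j/2) / 2^(m-1)); for odd j, (j -+ 1) / 2^m is
   ((j -+ 1)/2) / 2^(m-1). *)
Fixpoint Qgrid (R : realType) (v : nat -> nat -> R) (m j : nat) : R :=
  if m is m'.+1 then
    if odd j then
      Qgrid v m' j.-1./2 * (1 - v m j) + Qgrid v m' j.+1./2 * v m j
    else Qgrid v m' j./2
  else j%:R.

(* The left endpoint of the cell [k / 2^m, (k+1) / 2^m) containing y is
   k = cell m y. *)
Definition cell (R : realType) (m : nat) (y : R) : nat := Num.truncn (2 ^+ m * y).

(* Meaningful for 0 <= y <= 1.  At y = 1 the cell index is 2^m and the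
   out-of-range value Qgrid v m (2^m + 1) is multiplied by 0. *)
Definition Qlevel (R : realType) (v : nat -> nat -> R) (m : nat) (y : R) : R :=
  let k := cell m y in
  Qgrid v m k + (2 ^+ m * y - k%:R) * (Qgrid v m k.+1 - Qgrid v m k).

(* Meaningful for 0 < y < 1 off the grid j / 2^m, where y lies in
   ((j-1) / 2^m, j / 2^m) with j = cell m y + 1; the values on the (Lebesgue
   null) grid are irrelevant. *)
Definition qlevel (R : realType) (v : nat -> nat -> R) (m : nat) (y : R) : R :=
  (Qgrid v m (cell m y).+1 - Qgrid v m (cell m y)) / 2^-1 ^+ m.

(* [lim] is total; it is the limit only where the sequence converges. *)
Definition Qlimit (R : realType) (v : nat -> nat -> R) (y : R) : R :=
  limn (fun m => Qlevel v m y).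

(* Main.v *)
(* Write D for an increment of Q_m over a cell of level m.  The energy
   S_m = \int_0^1 q_m^2 = 2^m \sum_j D_{m,j}^2 is nondecreasing in m, since q_m
   is a dyadic average of q_{m+1}.  As D_{m,j} is independent of V_{m+1,2j+1}
   and E V^2 + E (1 - V)^2 = 1/2 + 2 sigma^2 + 2 delta^2, one has
   E S_{m+1} <= (1 + 4 sigma_{m+1}^2 + 4 delta_{m+1}^2) E S_m, so E S_m is
   bounded and, by monotone convergence, sup_m S_m is almost surely finite.
   The rest is deterministic: \int (q_n - q_m)^2 = S_n - S_m for m <= n, so a
   bounded energy makes (q_m) Cauchy in L^2, and a subsequence converges in L^1
   to some q whose integral over a dyadic cell is the increment of Q over it.
   Hence q_m(y) is the average of q over the cell of level m containing y, and
   Lebesgue's differentiation theorem gives q_m -> q almost everywhere. *)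
Require Import Defs.
From HB Require Import structures.
From mathcomp Require Import all_boot all_order all_algebra.
From mathcomp Require Import all_classical all_reals all_analysis.
From mathcomp Require Import measurable_realfun ring lra.

Set Implicit Arguments.
Unset Strict Implicit.
Unset Printing Implicit Defensive.

Import Order.TTheory GRing.Theory Num.Theory.
Import numFieldNormedType.Exports.

Local Open Scope classical_set_scope.
Local Open Scope ring_scope.

(** * Independence: factorising expectations of products *)

Section independence.
Context d (T : measurableType d) (R : realType) (P : probability T R).
Local Open Scope ereal_scope.
Import HBNNSimple.

(** The last hypothesis is the claim for indicators of events of [X]. A simple [h] is a finite
    combination of indicators of its fibres, and linearity does the rest. *)
Lemma integral_mul_nnsfun_comp (C : set T) (Y X : T -> R) (a : R)
    (h : {nnsfun R >-> R}) :
  measurable C -> measurable_fun setT Y -> measurable_fun setT X ->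
  (forall w, 0 <= Y w)%R -> (0 <= a)%R ->
  (forall A, measurable A ->
     \int[P]_(w in C `&` X @^-1` A) (Y w)%:E = a%:E * P (X @^-1` A)) ->
  \int[P]_(w in C) (Y w * h (X w))%:E = a%:E * \int[P]_w (h (X w))%:E.
Proof.
move=> mC mY mX Y0 a0 hA.
have mXA A : measurable A -> measurable (X @^-1` A).
  by move=> mA; rewrite -[X @^-1` A]setTI; exact: mX.
pose s : seq R := finmap.enum_fset (fset_set (range h)).
have s0 r : r \in s -> (0 <= r)%R.
  by rewrite [r \in s]in_fset_set// inE => -[x _ <-].
have hE x : (h x = \sum_(r <- s) r * \1_(h @^-1` [set r]) x)%R.
  by rewrite fimfunE fsbig_finite.
have mB r : measurable (X @^-1` (h @^-1` [set r])).
  by apply: mXA; exact: measurable_sfunP.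
have step (D : set T) (Z : T -> R) : measurable D -> measurable_fun setT Z ->
    (forall w, 0 <= Z w)%R ->
    \int[P]_(w in D) (Z w * h (X w))%:E =
    \sum_(r <- s) r%:E *
      \int[P]_(w in D `&` X @^-1` (h @^-1` [set r])) (Z w)%:E.
  move=> mD mZ Z0.
  (* The absolute value makes the summand nonnegative for every real r, not only for the values in
     [s], as exchanging sum and integral demands. *)
  transitivity (\int[P]_(w in D) \sum_(r <- s) `|r|%:E *
      ((Z w)%:E * (\1_(X @^-1` (h @^-1` [set r])) w)%:E)).
    apply: eq_integral => w _; rewrite hE mulr_sumr -sumEFin.
    rewrite !big_seq; apply: eq_bigr => r rs.
    by rewrite -!EFinM ger0_norm ?s0// mulrCA.
  rewrite ge0_integral_sum//.
  - rewrite !big_seq; apply: eq_bigr => r rs; rewrite ger0_norm ?s0//.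
    rewrite ge0_integralZl//.
    + congr (_ * _); rewrite integral_mkcondr; apply: eq_integral => w _.
      by rewrite epatch_indic.
    + apply/measurable_EFinP/measurable_funM; exact: measurable_funTS.
    + by move=> w _; rewrite lee_fin mulr_ge0.
    + by rewrite lee_fin s0.
  - move=> r; apply/measurable_EFinP/measurable_funM => //.
    apply/measurable_funM; exact: measurable_funTS.
  - by move=> r w _; rewrite lee_fin !mulr_ge0.
rewrite step//.
(* The right-hand side gets the same expansion, with weight 1 on the whole space. *)
under [in RHS]eq_integral do rewrite -[h _]mul1r.
rewrite (step setT (cst 1%R))// !big_seq ge0_sume_distrr; last first.
  by move=> r rs; rewrite mule_ge0 ?lee_fin ?s0// integral_ge0.
apply: eq_bigr => r _; rewrite muleCA; congr (_ * _).
by rewrite hA// setTI -[P _]mul1e -(integral_cst P (mB r)).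
Qed.

(** Simple functions increase to [g], and monotone convergence carries the simple case over on both
    sides. *)
Lemma integral_mul_comp (C : set T) (Y X : T -> R) (a : R) (g : R -> R) :
  measurable C -> measurable_fun setT Y -> measurable_fun setT X ->
  (forall w, 0 <= Y w)%R -> (0 <= a)%R ->
  measurable_fun setT g -> (forall x, 0 <= g x)%R ->
  (forall A, measurable A ->
     \int[P]_(w in C `&` X @^-1` A) (Y w)%:E = a%:E * P (X @^-1` A)) ->
  \int[P]_(w in C) (Y w * g (X w))%:E = a%:E * \int[P]_w (g (X w))%:E.
Proof.
move=> mC mY mX Y0 a0 mg g0 hA.
have mgE : measurable_fun setT (EFin \o g) by exact/measurable_EFinP.
pose h n := nnsfun_approx measurableT mgE n.
have hcvg x : (h n x)%:E @[n --> \oo] --> (g x)%:E.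
  by apply: (cvg_nnsfun_approx _ mgE) => // y _; rewrite lee_fin.
have hnd x : {homo (fun n => h n x) : m n / (m <= n)%N >-> (m <= n)%R}.
  by move=> m n mn; have /lefP := nd_nnsfun_approx measurableT mgE mn; exact.
(* Used twice: with weight [Y] on [C], and with weight 1 on the whole space. *)
have mc (D : set T) (Z : T -> R) : measurable D -> measurable_fun setT Z ->
    (forall w, 0 <= Z w)%R ->
    \int[P]_(w in D) (Z w * h n (X w))%:E @[n --> \oo] -->
    \int[P]_(w in D) (Z w * g (X w))%:E.
  move=> mD mZ Z0.
  have E : \int[P]_(w in D) (Z w * g (X w))%:E =
      \int[P]_(w in D) limn (fun n => (Z w * h n (X w))%:E).
    apply: eq_integral => w _; apply/esym/cvg_lim => //.
    under eq_fun do rewrite EFinM; rewrite EFinM.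
    by apply: cvgeZl => //; exact: hcvg.
  rewrite E; apply: cvg_monotone_convergence => //.
  - move=> n; apply/measurable_EFinP/measurable_funM.
      exact: measurable_funTS.
    by apply: measurable_funTS; exact: measurableT_comp.
  - by move=> n w _; rewrite lee_fin mulr_ge0.
  - by move=> w _ m n mn; rewrite lee_fin ler_wpM2l// hnd.
have L := mc C Y mC mY Y0.
have := mc setT (cst 1%R) measurableT (measurable_cst _) (fun _ => ler01).
under eq_fun do under eq_integral do rewrite mul1r.
under eq_integral do rewrite mul1r.
move=> /(@cvgeZl _ _ _ _ _ a%:E)-/(_ isT).
under eq_fun do rewrite -(integral_mul_nnsfun_comp _ mC mY mX Y0 a0 hA).
by move=> M; exact: (cvg_unique _ L M).
Qed.

Variables (I : choiceType) (X : I -> T -> R) (D : set I).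

(* [Y] behaves as if it were a function of the [X i], [i] in [E]. *)
Definition indep_outside (E : set I) (Y : T -> R) :=
  forall (s : seq I) (A : I -> set R),
    uniq s -> [set` s] `<=` D `\` E -> (forall i, measurable (A i)) ->
    \int[P]_(w in \bigcap_(i in [set` s]) (X i @^-1` A i)) (Y w)%:E =
    \int[P]_w (Y w)%:E * \prod_(i <- s) P (X i @^-1` A i).

Hypothesis mX : forall i, measurable_fun setT (X i).

Lemma indep_outside1 : mutually_independent P D X ->
  indep_outside set0 (cst 1%R).
Proof.
move=> ind s A us sD mA; rewrite setD0 in sD.
have mC : measurable (\bigcap_(i in [set` s]) (X i @^-1` A i)).
  apply: fin_bigcap_measurable => // i _.
  by rewrite -[_ @^-1` _]setTI; exact: mX.
have int1 C : measurable C -> \int[P]_(w in C) ((cst 1%R : T -> R) w)%:E = P C.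
  by move=> ?; rewrite -[P C]mul1e -(integral_cst P).
by rewrite !int1// ind// probability_setT mul1e.
Qed.

Lemma indep_outsideS (E E' : set I) (Y : T -> R) :
  E `<=` E' -> indep_outside E Y -> indep_outside E' Y.
Proof.
move=> EE' indY s A us sD mA; apply: indY => //.
by apply: (subset_trans sD); exact: setDS.
Qed.

(** Induction step along the pyramid, [X i] being a fresh variable. Both claims come from one
    formula, [key], over all events of the remaining variables; the empty family of events gives the
    first claim. *)
Lemma indep_outside_mul (E : set I) (Y : T -> R) (i : I) (g : R -> R) :
  measurable_fun setT Y -> (forall w, 0 <= Y w)%R ->
  \int[P]_w (Y w)%:E < +oo ->
  measurable_fun setT g -> (forall x, 0 <= g x)%R ->
  D i -> ~ E i -> indep_outside E Y ->
  \int[P]_w (Y w * g (X i w))%:E =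
    \int[P]_w (Y w)%:E * \int[P]_w (g (X i w))%:E /\
  indep_outside (i |` E) (fun w => Y w * g (X i w))%R.
Proof.
move=> mY Y0 Yfin mg g0 Di Ei indY.
have mpre k A : measurable A -> measurable (X k @^-1` A).
  by move=> mA; rewrite -[_ @^-1` _]setTI; exact: mX.
have intY0 : 0 <= \int[P]_w (Y w)%:E.
  by apply: integral_ge0 => w _; rewrite lee_fin.
have key (s : seq I) (A : I -> set R) : uniq s ->
    [set` s] `<=` D `\` (i |` E) ->
    (forall k, measurable (A k)) ->
    \int[P]_(w in \bigcap_(k in [set` s]) (X k @^-1` A k))
      (Y w * g (X i w))%:E =
    \int[P]_w (Y w)%:E * \prod_(k <- s) P (X k @^-1` A k) *
      \int[P]_w (g (X i w))%:E.
  move=> us sD mA.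
  have is_ : i \notin s.
    by apply/negP => /sD[_]; apply; left.
  have fin : \int[P]_w (Y w)%:E * \prod_(k <- s) P (X k @^-1` A k)
      \is a fin_num.
    rewrite fin_numM//; first by rewrite ge0_fin_numE.
    elim: s {us sD is_} => [|k s IH]; rewrite ?big_nil// big_cons fin_numM//.
    by rewrite fin_num_measure//; exact: mpre.
  rewrite -(fineK fin); apply: integral_mul_comp => //.
  - by apply: fin_bigcap_measurable => // k _; exact: mpre.
  - by rewrite fine_ge0// mule_ge0// prode_ge0.
  move=> B mB; rewrite (fineK fin).
  (* Prescribing [B] at [i] turns the event of [X i] into one more member of the family, so [indY]
     applies to [i :: s]. *)
  pose A' k := if k == i then B else A k.
  have sA' k : k \in s -> A' k = A k.
    by rewrite /A'; case: eqP => // ->; rewrite (negbTE is_).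
  have -> : \bigcap_(k in [set` s]) (X k @^-1` A k) `&` X i @^-1` B =
      \bigcap_(k in [set` i :: s]) (X k @^-1` A' k).
    apply/seteqP; split=> [w [h Bw] k|w h].
      rewrite /= inE => /predU1P[->|ks]; first by rewrite /A' eqxx.
      by rewrite sA'//; exact: h.
    split; last by have := h i; rewrite /= inE /A' eqxx; exact.
    by move=> k ks; have := h k; rewrite /= inE sA'//; apply; rewrite ks orbT.
  rewrite indY/=.
  - rewrite big_cons /A' eqxx muleCA muleC; congr (_ * _ * _).
    by rewrite !big_seq; apply: eq_bigr => k /sA'; rewrite /A' => ->.
  - by rewrite is_.
  - move=> k; rewrite /= inE => /predU1P[->//|/sD[Dk Ek]].
    by split=> // Ek'; apply: Ek; right.
  - by move=> k; rewrite /A'; case: ifP.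
have E0 : \int[P]_w (Y w * g (X i w))%:E =
    \int[P]_w (Y w)%:E * \int[P]_w (g (X i w))%:E.
  have := @key [::] (fun=> setT) isT; rewrite big_nil mule1.
  rewrite (_ : \bigcap_(k in _) _ = setT); last first.
    by apply/seteqP; split=> // w _ k.
  by apply => // k; rewrite /= in_nil.
by split=> // s A us sD mA; rewrite key// E0 muleAC.
Qed.

End independence.

(** * Dyadic sums, increments of the pyramid and the energy identity *)

Lemma sum_pow2S (V : nmodType) (m : nat) (F : nat -> V) :
  \sum_(i < 2 ^ m.+1) F i = \sum_(j < 2 ^ m) (F j.*2 + F j.*2.+1).
Proof.
rewrite -(big_mkord xpredT F).
rewrite -(big_mkord xpredT (fun j => F j.*2 + F j.*2.+1)) expnS mul2n.
elim: (2 ^ m)%N => [|n IH]; first by rewrite !big_geq.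
by rewrite doubleS !big_nat_recr//= IH addrA.
Qed.

Lemma divn_pow2_double (i k : nat) : (i.*2 %/ 2 ^ k.+1 = i %/ 2 ^ k)%N.
Proof. by rewrite expnS divnMA -muln2 mulnK. Qed.

Lemma divn_pow2_doubleS (i k : nat) : (i.*2.+1 %/ 2 ^ k.+1 = i %/ 2 ^ k)%N.
Proof.
by rewrite expnS divnMA divn2 -[i.*2.+1]/(true + i.*2)%N half_bit_double.
Qed.

Section increments.
Context {R : realType} (v : nat -> nat -> R).

Definition Qinc (m j : nat) : R := Qgrid v m j.+1 - Qgrid v m j.

(* [\int_0^1 q_m ^ 2] *)
Definition energy (m : nat) : R := 2 ^+ m * \sum_(j < 2 ^ m) Qinc m j ^+ 2.

Lemma QincS_even m j : Qinc m.+1 j.*2 = Qinc m j * v m.+1 j.*2.+1.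
Proof. by rewrite /Qinc /= odd_double /= ?uphalf_double ?doubleK; ring. Qed.

Lemma QincS_odd m j : Qinc m.+1 j.*2.+1 = Qinc m j * (1 - v m.+1 j.*2.+1).
Proof. by rewrite /Qinc /= odd_double /= ?uphalf_double ?doubleK; ring. Qed.

Lemma Qgrid0 m : Qgrid v m 0 = 0.
Proof. by elim: m. Qed.

Lemma Qgrid_end m : Qgrid v m (2 ^ m) = 1.
Proof.
elim: m => //= m IH.
by rewrite expnS mul2n odd_double doubleK.
Qed.

Lemma sum_Qinc m n : \sum_(j < n) Qinc m j = Qgrid v m n.
Proof.
by rewrite -(big_mkord xpredT (Qinc m)) telescope_sumr// Qgrid0 subr0.
Qed.

(** [i %/ 2 ^ k] is the level-m ancestor of cell [i]. The two children of a cell with increment D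
    have increments D V and D (1 - V), which add up to D. *)
Lemma sum_Qinc_coarse m k (c : nat -> R) :
  \sum_(i < 2 ^ (m + k)) Qinc (m + k) i * c (i %/ 2 ^ k)%N =
  \sum_(j < 2 ^ m) Qinc m j * c j.
Proof.
elim: k => [|k IH]; first by rewrite addn0; under eq_bigr do rewrite divn1.
rewrite addnS (sum_pow2S _ (fun i => Qinc _ i * c (i %/ _)%N)) -IH.
apply: eq_bigr => j _.
by rewrite divn_pow2_double divn_pow2_doubleS QincS_even QincS_odd; ring.
Qed.

Lemma sum_coarse m k (c : nat -> R) :
  \sum_(i < 2 ^ (m + k)) c (i %/ 2 ^ k)%N = 2 ^+ k * \sum_(j < 2 ^ m) c j.
Proof.
elim: k => [|k IH].
  by rewrite addn0 expr0 mul1r; under eq_bigr do rewrite divn1.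
rewrite addnS (sum_pow2S _ (fun i => c (i %/ _)%N)) exprS -mulrA -IH mulr_sumr.
apply: eq_bigr => j _.
by rewrite divn_pow2_double divn_pow2_doubleS; ring.
Qed.

(** Pythagoras for a dyadic martingale. When the square is expanded, the cross term sees the fine
    increments only through their coarse sums, so it is twice [energy m]; the last term gives one
    copy back. *)
Lemma energyB m k :
  \sum_(i < 2 ^ (m + k)) (2 ^+ (m + k) * Qinc (m + k) i -
      2 ^+ m * Qinc m (i %/ 2 ^ k)%N) ^+ 2 / 2 ^+ (m + k) =
  energy (m + k) - energy m.
Proof.
have p0 n : 2 ^+ n != 0 :> R by rewrite expf_neq0.
transitivity (2 ^+ (m + k) * (\sum_(i < 2 ^ (m + k)) Qinc (m + k) i ^+ 2) -
    2 * 2 ^+ m *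
      (\sum_(i < 2 ^ (m + k)) Qinc (m + k) i * Qinc m (i %/ 2 ^ k)%N) +
    2 ^+ m / 2 ^+ k * (\sum_(i < 2 ^ (m + k)) Qinc m (i %/ 2 ^ k)%N ^+ 2)).
  rewrite !mulr_sumr -sumrN -!big_split/=; apply: eq_bigr => i _.
  by rewrite exprD; field; rewrite !p0.
rewrite (sum_Qinc_coarse m k (Qinc m)).
rewrite (sum_coarse m k (fun j => Qinc m j ^+ 2)) /energy.
under [X in _ - _ * X]eq_bigr do rewrite -expr2.
by field; rewrite p0.
Qed.

Lemma energy_ge_Qinc m j : (j < 2 ^ m)%N -> 2 ^+ m * Qinc m j ^+ 2 <= energy m.
Proof.
move=> jm; rewrite ler_wpM2l ?exprn_ge0//.
rewrite (bigD1 (Ordinal jm))//= lerDl; apply: sumr_ge0 => i _; exact: sqr_ge0.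
Qed.

Lemma energy_homo : {homo energy : m n / (m <= n)%N >-> m <= n}.
Proof.
move=> m n mn; rewrite -(subnKC mn) -subr_ge0 -energyB; apply: sumr_ge0 => i _.
by rewrite divr_ge0 ?sqr_ge0 ?exprn_ge0.
Qed.

Hypothesis v01 : forall m j, pyramid_index m j -> 0 <= v m j <= 1.

Lemma pyramid_indexS m j : (j < 2 ^ m)%N -> pyramid_index m.+1 j.*2.+1.
Proof.
by move=> jm; rewrite /pyramid_index /= odd_double expnS mul2n ltn_Sdouble.
Qed.

Lemma Qinc_ge0_le1 m j : (j < 2 ^ m)%N -> 0 <= Qinc m j <= 1.
Proof.
elim: m j => [|m IH] j.
  by case: j => //= _; rewrite /Qinc/= subr0 ler01 lexx.
rewrite -[j]odd_double_half => jm.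
have {}jm : (j./2 < 2 ^ m)%N.
  rewrite -ltn_double -(mul2n (2 ^ m)) -expnS.
  by rewrite (leq_ltn_trans _ jm)// leq_addl.
have /andP[d0 d1] := IH _ jm; have /andP[v0 v1] := v01 (pyramid_indexS jm).
case: (odd j); rewrite ?[(true + _)%N]add1n ?[(false + _)%N]add0n.
  rewrite QincS_odd; apply/andP; split; first by rewrite mulr_ge0// subr_ge0.
  by apply: mulr_ile1 => //; lra.
by rewrite QincS_even; apply/andP; split; [exact: mulr_ge0|exact: mulr_ile1].
Qed.

End increments.

(** * Dyadic cells and integrals of step functions *)

Section cells.
Context {R : realType}.
Local Notation mu := (@lebesgue_measure R).
Implicit Types (m k n : nat) (y : R) (p : pred nat).

Lemma pow2_gt0 m : 0 < 2 ^+ m :> R.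
Proof. by rewrite exprn_gt0. Qed.

Lemma cell_itv m y : 0 <= y -> (cell m y)%:R <= 2 ^+ m * y < (cell m y).+1%:R.
Proof. by move=> y0; apply: truncn_itv; rewrite mulr_ge0// ltW// pow2_gt0. Qed.

Lemma cell_eq m n y : n%:R <= 2 ^+ m * y < n.+1%:R -> cell m y = n.
Proof. exact: truncn_def. Qed.

Lemma cell_lt m n y : 0 <= y -> (cell m y < n)%N = (y < n%:R / 2 ^+ m).
Proof.
move=> y0; have y2 : 0 <= 2 ^+ m * y by rewrite mulr_ge0// ltW// pow2_gt0.
rewrite /cell truncn_lt_nat//.
by rewrite ltr_pdivlMr ?pow2_gt0// mulrC.
Qed.

(** Nested floors: truncating 2^k x and then dividing by 2^k recovers the truncation of x = 2^m y.
    Fine indices thus yield their ancestors. *)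
Lemma cell_coarse m k y : 0 <= y -> cell m y = (cell (m + k) y %/ 2 ^ k)%N.
Proof.
move=> y0; apply: cell_eq.
have /andP[c1 c2] := cell_itv (m + k) y0; set c := cell _ _ in c1 c2 *.
have kgt0 : (0 < 2 ^ k)%N by rewrite expn_gt0.
have E : 2 ^+ (m + k) * y = (2 ^+ m * y) * (2 ^ k)%:R.
  by rewrite natrX exprD; ring.
rewrite -(ler_pM2r (_ : 0 < (2 ^ k)%:R)) ?ltr0n//.
rewrite -(ltr_pM2r (_ : 0 < (2 ^ k)%:R)) ?ltr0n// -E -!natrM.
apply/andP; split; first by rewrite (le_trans _ c1)// ler_nat leq_trunc_div.
by rewrite (lt_le_trans c2)// ler_nat ltn_ceil.
Qed.

Lemma measurable_cell m n : measurable [set y : R | cell m y = n].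
Proof.
(* The index, read as a real number, is monotone in y. *)
have mf : measurable_fun [set: R] (fun y => (cell m y)%:R : R).
  apply: nondecreasing_measurable => // x y xy.
  by rewrite ler_nat le_truncn// ler_wpM2l// ltW// pow2_gt0.
have := mf measurableT [set n%:R] (measurable_set1 _); rewrite setTI.
congr measurable; apply/seteqP; split=> y /=; last by move=> ->.
by move/eqP; rewrite eqr_nat => /eqP.
Qed.

Lemma measurable_cell_pred m p : measurable [set y : R | p (cell m y)].
Proof.
have -> : [set y : R | p (cell m y)] =
    \bigcup_(n in [set n | p n]) [set y | cell m y = n].
  apply/seteqP; split=> [y /= py|y [n /= pn]]; first by exists (cell m y).
  by move=> /= ->.
by apply: bigcup_measurable => n _; exact: measurable_cell.
Qed.

Lemma measurable_fun_cell m (g : nat -> R) :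
  measurable_fun [set: R] (fun y => g (cell m y)).
Proof.
move=> _ Y mY; rewrite setTI.
have := measurable_cell_pred m (fun n => `[< Y (g n) >]).
by congr measurable; apply/seteqP; split=> y /asboolP.
Qed.

Lemma measurable_qlevel (v : nat -> nat -> R) m :
  measurable_fun setT (qlevel v m).
Proof. exact: (measurable_fun_cell m (fun n => Qinc v m n / 2^-1 ^+ m)). Qed.

Local Open Scope ereal_scope.

(** Induction on [n]: each further half-open cell has length 2^-m, and the integrand is constant on
    it. *)
Lemma integral_cell m (g : nat -> R) n :
  (forall i, (i < n)%N -> 0 <= g i)%R ->
  \int[mu]_(y in `[0%R, (n%:R / 2 ^+ m)%R[) (g (cell m y))%:E =
  (\sum_(i < n) g i / 2 ^+ m)%:E.
Proof.
move=> g0; have pm := pow2_gt0 m.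
elim: n g0 => [|n IH] g0.
  by rewrite mul0r set_itvco0 integral_set0 big_ord0.
have le1 : (n%:R / 2 ^+ m <= n.+1%:R / 2 ^+ m :> R)%R.
  by rewrite ler_pM2r ?invr_gt0// ler_nat.
have ge0 : (0 <= n%:R / 2 ^+ m :> R)%R by rewrite divr_ge0// ltW.
rewrite (@itv_bndbnd_setU _ _ _ (BLeft (n%:R / 2 ^+ m)%R))//.
rewrite ge0_integral_setU//=; last 3 first.
- apply/measurable_EFinP/measurable_funTS; exact: (measurable_fun_cell m g).
- move=> y yn; rewrite lee_fin g0//.
  have /andP[y0 yn1] : (0 <= y < n.+1%:R / 2 ^+ m)%R.
    by case: yn => /=; rewrite in_itv/= => /andP[ya yb]; apply/andP; lra.
  by rewrite cell_lt.
- apply/disj_setPLR => y/=; rewrite !in_itv/= => /andP[_ yn].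
  by apply/negP; rewrite (lt_geF yn).
rewrite IH; last by move=> i /ltnW; exact: g0.
rewrite big_ord_recr/= EFinD; congr (_ + _).
rewrite (eq_integral (fun=> (g n)%:E)); last first.
  move=> y; rewrite inE/= in_itv/= => /andP[y1 y2]; congr (g _)%:E.
  by apply: cell_eq; rewrite mulrC -ler_pdivrMr// y1 -ltr_pdivlMr.
rewrite integral_cst//= lebesgue_measure_itv/= lte_fin.
rewrite ltr_pM2r ?invr_gt0// ltr_nat ltnSn -EFinB -EFinM.
by rewrite -mulrBl -natrB// subSnn mul1r.
Qed.

Lemma integral_cell1 m (g : nat -> R) :
  (forall i, (i < 2 ^ m)%N -> 0 <= g i)%R ->
  \int[mu]_(y in `[0%R, 1%R[) (g (cell m y))%:E =
  (\sum_(i < 2 ^ m) g i / 2 ^+ m)%:E.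
Proof.
move=> g0; rewrite -integral_cell//.
by rewrite natrX divff// expf_neq0.
Qed.

End cells.

(** * Masses and L^2 distances of the derivatives q_m *)

Section qlevel_integrals.
Context {R : realType} (v : nat -> nat -> R).
Local Notation mu := (@lebesgue_measure R).
Hypothesis v01 : forall m j, pyramid_index m j -> 0 <= v m j <= 1.

Lemma qlevelE m y : qlevel v m y = 2 ^+ m * Qinc v m (cell m y).
Proof. by rewrite /qlevel exprVn invrK mulrC. Qed.

Lemma cell_lt1 m (y : R) : 0 <= y < 1 -> (cell m y < 2 ^ m)%N.
Proof. by case/andP=> y0 y1; rewrite cell_lt// natrX divff ?expf_neq0. Qed.

Lemma qlevel_ge0 m (y : R) : 0 <= y < 1 -> 0 <= qlevel v m y.
Proof.
move=> y01; rewrite qlevelE mulr_ge0 ?exprn_ge0//.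
by have /andP[] := Qinc_ge0_le1 v01 (cell_lt1 m y01).
Qed.

(** Refinement conserves mass, so the value does not depend on [k]; a limit along finer levels can
    therefore be read off at level m. *)
Lemma integral_qlevel m k (p : pred nat) :
  (\int[mu]_(y in `[0%R, 1%R[ `&` [set y | p (cell m y)])
    (qlevel v (m + k) y)%:E)%E = (\sum_(j < 2 ^ m | p j) Qinc v m j)%:E.
Proof.
rewrite integral_mkcondr.
pose g i := 2 ^+ (m + k) * (Qinc v (m + k) i * (p (i %/ 2 ^ k)%N)%:R).
transitivity (\int[mu]_(y in `[0%R, 1%R[) (g (cell (m + k) y))%:E)%E.
  apply: eq_integral => y; rewrite inE/= in_itv/= => /andP[y0 y1].
  rewrite patchE /g -cell_coarse// qlevelE.
  case: ifPn; rewrite ?inE/= ?notin_setE/=; first by move=> ->; rewrite mulr1.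
  by move/negP/negbTE => ->; rewrite !mulr0.
rewrite integral_cell1; last first.
  move=> i im; have /andP[d0 _] := Qinc_ge0_le1 v01 im.
  by rewrite /g !mulr_ge0.
congr EFin; rewrite [RHS]big_mkcond/=.
transitivity (\sum_(i < 2 ^ (m + k)) Qinc v (m + k) i * (p (i %/ 2 ^ k)%N)%:R).
  by apply: eq_bigr => i _; rewrite /g mulrAC divff ?mul1r// expf_neq0.
rewrite (sum_Qinc_coarse v m k (fun j => (p j)%:R)).
by apply: eq_bigr => i _; case: (p i); rewrite ?mulr1 ?mulr0.
Qed.

Lemma integral_sqr_qlevelB m k :
  (\int[mu]_(y in `[0%R, 1%R[)
    ((qlevel v (m + k) y - qlevel v m y) ^+ 2)%:E)%E =
  (energy v (m + k) - energy v m)%:E.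
Proof.
rewrite -energyB.
rewrite -(integral_cell1 (g := fun i => (2 ^+ (m + k) * Qinc v (m + k) i -
      2 ^+ m * Qinc v m (i %/ 2 ^ k)%N) ^+ 2)); last first.
  by move=> *; exact: sqr_ge0.
apply: eq_integral => y; rewrite inE/= in_itv/= => /andP[y0 y1].
by rewrite !qlevelE (cell_coarse m k).
Qed.

End qlevel_integrals.

(** * Limits of rapidly converging sequences in L^1 *)

Section L1_limit.
Context d (T : measurableType d) (R : realType).
Variable mu : {measure set T -> \bar R}.
Local Open Scope ereal_scope.

Lemma nneseries_half_lty : \sum_(k <oo) (2^-1 ^+ k : R)%:E < +oo.
Proof.
apply: (@le_lt_trans _ _ 2%:E); last exact: ltry.
apply: lime_le; first by apply: is_cvg_nneseries => k _ _; rewrite lee_fin.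
apply: nearW => n; rewrite sumEFin lee_fin.
have := @geometric_le_lim R n 1%R 2^-1%R.
rewrite /series/= => /(_ ler01).
rewrite ger0_norm// (_ : 1 / (1 - 2^-1) = 2 :> R)%R; last by field.
move=> h; apply: le_trans (h _ _); rewrite ?invr_gt0 ?invf_lt1 ?ltr1n//.
by under [leRHS]eq_bigr do rewrite mul1r.
Qed.

(** The L^1 distances are summable, so [f 0] plus the sum of all absolute differences is an
    integrable dominating function, and the telescoping series converges absolutely wherever that
    sum is finite. Dominated convergence then acts on every measurable subset of [D]. *)
Lemma L1_fast_limit (D : set T) (f : (T -> R)^nat) :
  measurable D -> (forall k, measurable_fun D (f k)) ->
  (forall k y, D y -> (0 <= f k y)%R) ->
  mu.-integrable D (EFin \o f 0%N) ->
  (forall k, \int[mu]_(y in D) `|f k.+1 y - f k y|%:E <= (2^-1 ^+ k)%:E) ->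
  exists q : T -> R, [/\ forall y, (0 <= q y)%R,
    mu.-integrable D (EFin \o q) &
    forall E, measurable E -> E `<=` D ->
      \int[mu]_(y in E) (f k y)%:E @[k --> \oo] --> \int[mu]_(y in E) (q y)%:E].
Proof.
move=> mD mf f0 if0 hf.
pose G y := \sum_(k <oo) `|f k.+1 y - f k y|%:E.
have mdf k : measurable_fun D (fun y => `|f k.+1 y - f k y|%:E).
  by apply/measurable_EFinP/measurableT_comp => //; exact: measurable_funB.
have mG : measurable_fun D G.
  by apply: ge0_emeasurable_sum => // k y _ _; rewrite lee_fin.
have G0 y : 0 <= G y by apply: nneseries_ge0 => k _ _; rewrite lee_fin.
have iG : mu.-integrable D G.
  apply/integrableP; split=> //.
  under eq_integral do rewrite gee0_abs//.
  rewrite integral_nneseries//.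
  apply: (le_lt_trans _ nneseries_half_lty); apply: lee_nneseries => // k _.
  by rewrite integral_ge0// => y _; rewrite lee_fin.
(* The limsup is measurable by itself, and the absolute value keeps [q] nonnegative even at points
   without a limit. *)
pose q y := `|fine (limn_esup (fun k => (f k y)%:E))|%R.
have mq : measurable_fun D q.
  apply: measurableT_comp => //; apply: measurableT_comp.
    exact: fine_measurable.
  by apply: measurable_fun_limn_esup => k; exact/measurable_EFinP.
pose h y := (f 0%N y)%:E + G y.
have ih : mu.-integrable D h by exact: integrableD.
have fh k y : D y -> `|(f k y)%:E| <= h y.
  move=> Dy; rewrite gee0_abs ?lee_fin ?f0//.
  apply: (@le_trans _ _ ((f 0%N y)%:E +
      \sum_(0 <= i < k) `|f i.+1 y - f i y|%:E)).
    rewrite sumEFin -EFinD lee_fin.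
    rewrite -lerBlDl -(telescope_sumr (f^~ y)) //.
    by apply: ler_sum => i _; exact: ler_norm.
  by rewrite leeD2l// nneseries_lim_ge.
have fq : {ae mu, forall y, D y -> (f k y)%:E @[k --> \oo] --> (q y)%:E}.
  apply: filterS (integrable_ae mD iG) => y Gy Dy.
  have cf : cvgn (f^~ y).
    have cs : cvgn (series (telescope (f^~ y))).
      apply: normed_cvg.
      apply: nondecreasing_is_cvgn.
        by apply: nondecreasing_series => k _ _; exact: normr_ge0.
      exists (fine (G y)) => _ [n _ <-] /=.
      rewrite -lee_fin fineK ?Gy// -sumEFin.
      exact: nneseries_lim_ge.
    have -> : f^~ y = fun n => (f 0%N y + series (telescope (f^~ y)) n)%R.
      by apply/funext => n; rewrite -eq_sum_telescope.
    by apply: is_cvgD => //; exact: is_cvg_cst.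
  apply: cvg_EFin; first exact: nearW.
  move/cvg_ex: cf => [l fl].
  have l0 : (0 <= l)%R.
    have <- : limn (f^~ y) = l by exact/cvg_lim.
    by apply: limr_ge; [apply/cvg_ex; exists l|apply: nearW => k; exact: f0].
  rewrite /q is_cvg_limn_esupE; last first.
    apply/cvg_ex; exists l%:E; apply: cvg_EFin => //; exact: nearW.
  rewrite (_ : limn _ = l%:E)/= ?ger0_norm//.
  by apply/cvg_lim => //; apply: cvg_EFin => //; exact: nearW.
have iq E : measurable E -> E `<=` D -> mu.-integrable E (EFin \o q) /\
   \int[mu]_(y in E) (f k y)%:E @[k --> \oo] --> \int[mu]_(y in E) (q y)%:E.
  move=> mE ED.
  have [|||||iqE _ cqE] := @dominated_convergence _ _ _ mu E mE
    (fun k y => (f k y)%:E) (EFin \o q) h.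
  - by move=> k; apply/measurable_EFinP; exact: measurable_funS (mf k).
  - by apply/measurable_EFinP; exact: measurable_funS mq.
  - by apply: filterS fq => y + /ED; exact.
  - exact: integrableS ih.
  - by apply: aeW => y k /ED; exact: fh.
  - by split.
exists q; split=> [y||]; first exact: normr_ge0.
  by have [] := iq _ mD (@subset_refl _ D).
by move=> E mE ED; have [] := iq E mE ED.
Qed.

End L1_limit.

Lemma fast_subsequence (R : realType) (u : R^nat) (B : R) :
  {homo u : m n / (m <= n)%N >-> m <= n} -> (forall n, u n <= B) ->
  exists n_ : nat -> nat, [/\ forall k, (k <= n_ k)%N,
    forall k, (n_ k <= n_ k.+1)%N &
    forall k, u (n_ k.+1) - u (n_ k) <= 4^-1 ^+ k].
Proof.
move=> ndu uB.
have ubu : has_ubound (range u) by exists B => _ [n _ <-].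
have cu := nondecreasing_cvgn ndu ubu; set L := sup _ in cu.
have uL n : u n <= L by apply: ub_le_sup => //; exists n.
have near_L k : {N | L - u N <= 4^-1 ^+ k}.
  apply: cid; have e0 : 0 < 4^-1 ^+ k :> R by rewrite exprn_gt0.
  move/cvgrPdist_le : cu => /(_ _ e0)[N _ hN]; exists N.
  by apply: le_trans (hN N (leqnn N)); exact: ler_norm.
pose N k := sval (near_L k).
(* The summand k forces k <= n_k. The partial sums make n_k nondecreasing and at least [N k], where
   [u] is within 4^-k of its limit. *)
exists (fun k => k + \sum_(i < k.+1) N i)%N; split=> k.
- exact: leq_addr.
- by rewrite leq_add// [leqRHS]big_ord_recr leq_addr.
- have Nk : (N k <= k + \sum_(i < k.+1) N i)%N.
    by rewrite big_ord_recr/= addnA leq_addl.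
  apply: (@le_trans _ _ (L - u (N k))); last exact: (svalP (near_L k)).
  by rewrite lerB// ndu.
Qed.

(** * Extraction of a density from bounded energy *)

Section absolute_continuity.
Context {R : realType} (v : nat -> nat -> R) (B : R).
Local Notation mu := (@lebesgue_measure R).
Hypothesis v01 : forall m j, pyramid_index m j -> 0 <= v m j <= 1.
Hypothesis energy_le : forall m, energy v m <= B.

(** The pointwise bound |x| <= e/2 + x^2/(2e) plays the role of Cauchy-Schwarz: with an energy gap
    of at most e^2 on an interval of length 1, each term integrates to at most e/2. *)
Lemma integral_norm_qlevelB m n (e : R) : (m <= n)%N -> 0 < e ->
  energy v n - energy v m <= e ^+ 2 ->
  (\int[mu]_(y in `[0%R, 1%R[) `|qlevel v n y - qlevel v m y|%:E <= e%:E)%E.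
Proof.
move=> mn e0 he.
have mq k : measurable_fun (`[0, 1[%classic : set R) (qlevel v k).
  by apply: measurable_funTS; exact: measurable_qlevel.
have mqB : measurable_fun (`[0, 1[%classic : set R)
    (fun y => qlevel v n y - qlevel v m y).
  exact: measurable_funB.
pose h (y : R) := ((2^-1 * e)%:E +
  ((2 * e)^-1)%:E * ((qlevel v n y - qlevel v m y) ^+ 2)%:E)%E.
apply: (@le_trans _ _ (\int[mu]_(y in `[0%R, 1%R[) h y)%E).
  apply: ge0_le_integral => //.
  - by apply/measurable_EFinP/measurableT_comp.
  - apply: emeasurable_funD => //; apply: measurable_funeM.
    by apply/measurable_EFinP/measurable_funX.
  - move=> y _; rewrite /h -EFinM -EFinD lee_fin.
    set x := _ - _; rewrite -(real_normK (num_real x)); set z := `|x|.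
    rewrite -subr_ge0.
    rewrite (_ : _ - _ = (2 * e)^-1 * (z - e) ^+ 2); last by field; lra.
    by rewrite mulr_ge0 ?sqr_ge0// invr_ge0; lra.
rewrite ge0_integralD//=; last 3 first.
- by move=> y _; rewrite lee_fin; lra.
- by move=> y _; rewrite -EFinM lee_fin mulr_ge0 ?sqr_ge0// invr_ge0; lra.
- apply: measurable_funeM.
  by apply/measurable_EFinP/measurable_funX.
rewrite integral_cst//= lebesgue_measure_itv/= lte_fin ltr01 oppr0 adde0 mule1.
rewrite ge0_integralZl//=; last 3 first.
- by apply/measurable_EFinP/measurable_funX.
- by move=> y _; rewrite lee_fin sqr_ge0.
- by rewrite lee_fin invr_ge0; lra.
have := integral_sqr_qlevelB v m (n - m); rewrite subnKC// => ->.
rewrite -EFinM -EFinD lee_fin.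
apply: (@le_trans _ _ (2^-1 * e + (2 * e)^-1 * e ^+ 2)).
  by rewrite lerD2l ler_wpM2l// invr_ge0; lra.
by rewrite le_eqVlt; apply/orP; left; apply/eqP; field; lra.
Qed.

(** The masses on level-m cells are constant along the fast subsequence from index m on, so they
    pass to its limit. *)
Lemma qlevel_L1_limit : exists q : R -> R, [/\ forall y, 0 <= q y,
  mu.-integrable setT (EFin \o q) &
  forall m (p : pred nat),
    (\int[mu]_(y in `[0%R, 1%R[ `&` [set y | p (cell m y)]) (q y)%:E)%E =
    (\sum_(j < 2 ^ m | p j) Qinc v m j)%:E].
Proof.
have [n_ [kn nn hn]] := fast_subsequence (energy_homo v) energy_le.
have [|||||q [q0 iq cq]] := @L1_fast_limit _ _ _ mu (`[0, 1[%classic : set R)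
   (fun k => qlevel v (n_ k)).
- exact: measurable_itv.
- by move=> k; apply: measurable_funTS; exact: measurable_qlevel.
- by move=> k y /=; rewrite in_itv/=; exact: qlevel_ge0.
- apply/integrableP; split.
    by apply/measurable_EFinP/measurable_funTS; exact: measurable_qlevel.
  (* Level 0 has the single cell [0, 1), so this is the total mass. *)
  have := integral_qlevel v01 0 (n_ 0%N) xpredT.
  rewrite add0n setIidl//.
  move=> h; rewrite (@le_lt_trans _ _
    (\int[mu]_(y in `[0%R, 1%R[) (qlevel v (n_ 0) y)%:E)%E)//.
    rewrite le_eqVlt; apply/orP; left; apply/eqP.
    apply: eq_integral => y; rewrite inE/= in_itv/= => y01.
    by rewrite ger0_norm// qlevel_ge0.
  by rewrite h ltry.
(* The choice e = 2^-k matches the gap 4^-k = e^2 of the fast subsequence. *)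
- move=> k; apply: integral_norm_qlevelB; [exact: nn|by rewrite exprn_gt0|].
  by rewrite exprAC (_ : 2^-1 ^+ 2 = 4^-1)//; field.
(* Extension by zero puts the density on the whole line, where Lebesgue differentiation is applied
   later. *)
exists (q \_ (`[0, 1[%classic : set R)); split.
- by move=> y; rewrite patchE; case: ifP.
- by move: iq; rewrite integrable_mkcond// restrict_EFin.
move=> m p.
pose E := `[0%R, 1%R[ `&` [set y : R | p (cell m y)].
have mE : measurable E by apply: measurableI => //; exact: measurable_cell_pred.
rewrite -/E.
transitivity (\int[mu]_(y in E) (q y)%:E)%E.
  apply: eq_integral => y; rewrite inE => -[y01 _].
  by rewrite patchE mem_set.
have := cq E mE (@subIsetl _ _ _).
move/cvg_unique; apply => //.
apply: cvg_near_cst; exists m => // k /= mk.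
have mn : (m <= n_ k)%N by exact: leq_trans (kn k).
by rewrite -(subnKC mn) integral_qlevel.
Qed.

End absolute_continuity.

(** * Q as the integral of q, and almost everywhere convergence of q_m *)

Section pyramid_density.
Context {R : realType} (v : nat -> nat -> R) (B : R).
Local Notation mu := (@lebesgue_measure R).
Hypothesis v01 : forall m j, pyramid_index m j -> 0 <= v m j <= 1.
Hypothesis energy_le : forall m, energy v m <= B.
Variable q : R -> R.
Hypothesis q0 : forall y, 0 <= q y.
Hypothesis iq : mu.-integrable setT (EFin \o q).
Hypothesis intq : forall m (p : pred nat),
  (\int[mu]_(y in `[0%R, 1%R[ `&` [set y | p (cell m y)]) (q y)%:E)%E =
  (\sum_(j < 2 ^ m | p j) Qinc v m j)%:E.

(** A single cell carries at most the total energy, so its increment D satisfies D^2 <= B / 2^m. *)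
Lemma Qinc_cell_cvg0 (y : R) : 0 <= y < 1 ->
  Qinc v m (cell m y) @[m --> \oo] --> 0.
Proof.
move=> y01; apply/cvgrPdist_lt => e e0.
have cB : geometric B 2^-1 n @[n --> \oo] --> 0.
  by apply: cvg_geometric; rewrite ger0_norm// invf_lt1// ltr1n.
have e20 : 0 < e ^+ 2 by rewrite exprn_gt0.
move/cvgrPdist_lt : cB => /(_ _ e20); apply: filterS => m.
rewrite !sub0r !normrN => hm.
have cm := cell_lt1 m y01.
have /andP[d0 _] := Qinc_ge0_le1 v01 cm.
suff : Qinc v m (cell m y) ^+ 2 < e ^+ 2.
  by rewrite ger0_norm// ltr_pXn2r// nnegrE ltW.
apply: le_lt_trans hm; apply: le_trans (ler_norm _).
rewrite /geometric/= exprVn ler_pdivlMr ?exprn_gt0// mulrC.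
exact: le_trans (energy_ge_Qinc v cm) (energy_le m).
Qed.

Lemma integral_q_grid m j : (j <= 2 ^ m)%N ->
  (\int[mu]_(y in `[0%R, (j%:R / 2 ^+ m)%R[) (q y)%:E)%E = (Qgrid v m j)%:E.
Proof.
move=> jm; rewrite -sum_Qinc.
have := intq m (fun i => i < j)%N.
rewrite -(big_ord_widen _ (Qinc v m) jm) => <-.
congr integral; apply/seteqP; split=> y /=; rewrite !in_itv/=.
  move=> /andP[yge0 yj]; rewrite yge0/= cell_lt//; split=> //.
  by rewrite (lt_le_trans yj)// ler_pdivrMr ?exprn_gt0// mul1r -natrX ler_nat.
by move=> [/andP[yge0 y1]]; rewrite cell_lt// yge0.
Qed.

(** The integral of the nonnegative [q] is monotone in its endpoint, and y lies between the ends of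
    its cell. *)
Lemma integral_q_cell m (y : R) : 0 <= y < 1 ->
  Qgrid v m (cell m y) <= \int[mu]_(u in `[0, y]) q u <=
    Qgrid v m (cell m y).+1.
Proof.
move=> y01; have cm := cell_lt1 m y01; have /andP[yge0 y1] := y01.
have mq (E : set R) : measurable_fun E (EFin \o q).
  exact: measurable_funTS (measurable_int _ iq).
have fin : (\int[mu]_(u in `[0%R, y]) (q u)%:E)%E \is a fin_num.
  by apply: integrable_fin_num => //; exact: integrableS iq.
have /andP[c1 c2] := cell_itv m yge0.
rewrite -!lee_fin fineK// -!integral_q_grid//; last exact: ltnW.
apply/andP; split; apply: ge0_subset_integral => //.
- exact: mq.
- by move=> z _; rewrite lee_fin.
- move=> z /=; rewrite !in_itv/= => /andP[-> zc]/=; apply: ltW.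
  by apply: (lt_le_trans zc); rewrite ler_pdivrMr ?exprn_gt0// mulrC.
- exact: mq.
- by move=> z _; rewrite lee_fin.
- move=> z /=; rewrite !in_itv/= => /andP[-> zy]/=.
  by apply: (le_lt_trans zy); rewrite ltr_pdivlMr ?exprn_gt0// mulrC.
Qed.

Lemma Qlevel1 m : Qlevel v m 1 = 1.
Proof.
have c1 : cell m (1 : R) = (2 ^ m)%N.
  by apply: cell_eq; rewrite mulr1 natrX lexx/= -natrX ltr_nat.
by rewrite /Qlevel c1 Qgrid_end mulr1 natrX subrr mul0r addr0.
Qed.

Lemma integral_q1 : \int[mu]_(u in `[0, 1]) q u = 1.
Proof.
rewrite -Rintegral_itv_bndo_bndc; last exact: integrableS iq.
have := @integral_q_grid 0 1 isT; rewrite expr0 divr1 /= => h.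
by rewrite /Rintegral h.
Qed.

(** Both Q_m(y) and the integral of [q] lie between the grid values at the two ends of the cell of
    y, so they differ by at most its increment, which tends to 0. *)
Lemma Qlevel_cvg (y : R) : 0 <= y <= 1 ->
  Qlevel v m y @[m --> \oo] --> \int[mu]_(u in `[0, y]) q u.
Proof.
move=> /andP[y0]; rewrite le_eqVlt => /predU1P[->|y1].
  (* At y = 1 the cell index leaves the range of the grid; both sides are exactly 1. *)
  rewrite integral_q1; under eq_fun do rewrite Qlevel1; exact: cvg_cst.
have y01 : 0 <= y < 1 by rewrite y0.
set F := Rintegral _ _ _.
apply/subr_cvg0; apply/norm_cvg0P.
apply: (@squeeze_cvgr _ _ _ _ (cst 0) (fun m => Qinc v m (cell m y))).
- apply: nearW => m; rewrite normr_ge0/=.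
  have /andP[F1 F2] := integral_q_cell m y01; rewrite -/F in F1 F2.
  have /andP[c1 c2] := cell_itv m y0.
  have /andP[d0 d1] := Qinc_ge0_le1 v01 (cell_lt1 m y01).
  rewrite /Qlevel; set k := cell m y in F1 F2 c1 c2 d0 d1 *.
  rewrite -/(Qinc v m k).
  set th := _ - k%:R.
  have th0 : 0 <= th by rewrite subr_ge0.
  have th1 : th <= 1 by rewrite lerBlDr addrC natr1 ltW.
  have t0 := mulr_ge0 th0 d0.
  have t1 : th * Qinc v m k <= Qinc v m k by rewrite ler_piMl.
  move: t0 t1; rewrite /Qinc => t0 t1.
  by rewrite ler_norml; apply/andP; split; lra.
- exact: cvg_cst.
- exact: Qinc_cell_cvg0.
Qed.

(* For [x < 0] this is a junk value: [nice_lebesgue_differentiation] wants a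
   nicely shrinking family at every real. *)
Let left_end (n : nat) (x : R) : R :=
  if 0 <= x then (cell n x)%:R / 2 ^+ n else x.

Let left_endP n x : left_end n x <= x < left_end n x + 2 ^- n.
Proof.
have p0 : 0 < 2 ^+ n :> R by rewrite exprn_gt0.
rewrite /left_end; case: ifPn => x0; last by rewrite lexx ltrDl invr_gt0.
have /andP[c1 c2] := cell_itv n x0.
rewrite ler_pdivrMr// mulrC c1 -[X in _ + X]mul1r -mulrDl natr1.
by rewrite ltr_pdivlMr// mulrC.
Qed.

Let E (x : R) n : set R := `[left_end n x, left_end n x + 2 ^- n[%classic.

Let muE x n : mu (E x n) = (2 ^- n)%:E.
Proof.
rewrite /E lebesgue_measure_itv/= lte_fin ltrDl invr_gt0 exprn_gt0//.
by rewrite -EFinB addrAC subrr add0r.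
Qed.

Let nice_E x : nicely_shrinking x (E x).
Proof.
have p0 n : 0 < 2 ^- n :> R by rewrite invr_gt0 exprn_gt0.
split=> [n|]; first exact: measurable_itv.
(* The ball of radius 2^-n around x contains the cell and is twice as long, whence the constant
   2. *)
exists (2, fun n => PosNum (p0 n)); split=> //=.
- have -> : (fun n => 2 ^- n : R) = geometric 1 2^-1.
    by apply/funext => n; rewrite /geometric/= mul1r exprVn.
  by apply: cvg_geometric; rewrite ger0_norm// invf_lt1// ltr1n.
- move=> n z; rewrite /E/= in_itv/= /ball/= => /andP[z1 z2].
  have /andP[x1 x2] := left_endP n x.
  by rewrite ltr_norml; apply/andP; split; lra.
- move=> n; rewrite (lebesgue_measure_ball _ (ltW (p0 n))) muE -EFinM.
  by rewrite mulr_natl.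
Qed.

(** This is the form of a cell to which [intq] applies, with a predicate singling out one index. *)
Let E_cell n y : 0 <= y < 1 ->
  E y n = `[0, 1[%classic `&` [set z | pred1 (cell n y) (cell n z)].
Proof.
move=> y01; have /andP[y0 _] := y01; have p0 := @pow2_gt0 R n.
rewrite /E /left_end y0 -[X in _ + X]mul1r -mulrDl natr1.
apply/seteqP; split=> z /=; rewrite !in_itv/=.
  rewrite ler_pdivrMr// ltr_pdivlMr// mulrC => cz.
  have z0 : 0 <= z.
    by rewrite -(pmulr_rge0 _ p0); case/andP: cz => cz _; exact: le_trans cz.
  have cellz := cell_eq cz; rewrite cellz; split=> //; rewrite z0/=.
  by have := cell_lt1 n y01; rewrite -cellz cell_lt// natrX divff ?gt_eqF.
move=> [/andP[z0 _] /eqP <-].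
by rewrite ler_pdivrMr// ltr_pdivlMr// mulrC cell_itv.
Qed.

(** The average of [q] over the level-n cell of y is q_n(y), and these cells shrink nicely to y; so
    convergence holds at every Lebesgue point of [q] in [0, 1). *)
Lemma qlevel_ae_cvg : {ae mu, forall y, 0 <= y <= 1 ->
  qlevel v m y @[m --> \oo] --> q y}.
Proof.
have locq : locally_integrable setT q.
  exact: (open_integrable_locally openT iq).
(* The point 1 is discarded: its cells lie outside [0, 1), where [intq] says nothing. *)
have ne1 : {ae mu, forall y : R, y != 1}.
  exists [set 1]; split=> //; first exact: lebesgue_measure_set1.
  by move=> y /= /negP; rewrite negbK => /eqP.
apply: (@filterS2 _ _ (ae_filter_ringOfSetsType mu) _ _ _ _
  (lebesgue_differentiation locq) ne1) => y ly y1 /andP[y0 yle1].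
have y01 : 0 <= y < 1 by rewrite y0 lt_neqAle y1.
have := nice_lebesgue_differentiation nice_E locq ly.
rewrite (_ : (fun n => _) = fun n => (qlevel v n y)%:E).
  by move/fine_cvgP => [].
apply/funext => n; rewrite muE inver.
rewrite gt_eqF ?invr_gt0 ?exprn_gt0// invrK qlevelE EFinM; congr (_ * _)%E.
rewrite E_cell// intq; congr EFin.
by rewrite (big_pred1 (Ordinal (cell_lt1 n y01))).
Qed.

End pyramid_density.

(** The deterministic half, for a single sample path. *)
Lemma density_of_bounded_energy (R : realType) (v : nat -> nat -> R) (B : R) :
  (forall m j, pyramid_index m j -> 0 <= v m j <= 1) ->
  (forall m, energy v m <= B) ->
  exists q : R -> R,
    [/\ (@lebesgue_measure R).-integrable `[0, 1] (EFin \o q),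
        {ae @lebesgue_measure R, forall y : R, 0 <= y <= 1 ->
           qlevel v m y @[m --> \oo] --> q y} &
        forall y : R, 0 <= y <= 1 ->
           Qlevel v m y @[m --> \oo] --> Qlimit v y /\
           Qlimit v y = \int[@lebesgue_measure R]_(u in `[0, y]) q u].
Proof.
move=> v01 eB; have [q [q0 iq intq]] := qlevel_L1_limit v01 eB.
exists q; split.
- exact: integrableS iq.
- exact: qlevel_ae_cvg.
move=> y y01; have cQ := Qlevel_cvg v01 eB q0 iq intq y01.
have E : Qlimit v y = \int[@lebesgue_measure R]_(u in `[0, y]) q u.
  exact/cvg_lim.
by rewrite E.
Qed.

(** * Second moments and the expected energy *)

Lemma second_moments d (T : measurableType d) (R : realType)
    (P : probability T R) (X : {RV P >-> R}) (m s : R) :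
  (forall w, 0 <= X w <= 1) -> ('E_P[X] = m%:E)%E -> ('V_P[X] = s%:E)%E ->
  (\int[P]_w (X w ^+ 2)%:E = (s + m ^+ 2)%:E /\
   \int[P]_w ((1 - X w) ^+ 2)%:E = (1 - 2 * m + s + m ^+ 2)%:E)%E.
Proof.
move=> X01 EX VX.
have X0 w : 0 <= X w by case/andP: (X01 w).
have mX : measurable_fun setT X by [].
have iX : (\int[P]_w (X w)%:E)%E = m%:E by rewrite -EX unlock.
have m0 : 0 <= m by rewrite -lee_fin -iX integral_ge0// => w _; rewrite lee_fin.
have iXm : (\int[P]_w ((X w - m) ^+ 2)%:E)%E = s%:E.
  rewrite -VX /variance unlock EX/= unlock; apply: eq_integral => w _.
  by rewrite /= expr2.
have intD (f g : T -> R) : measurable_fun setT f ->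
    measurable_fun setT g -> (forall w, 0 <= f w) -> (forall w, 0 <= g w) ->
    (\int[P]_w (f w + g w)%:E = \int[P]_w (f w)%:E + \int[P]_w (g w)%:E)%E.
  move=> mf mg f0 g0; rewrite -ge0_integralD//.
  - by move=> w _; rewrite lee_fin.
  - exact/measurable_EFinP.
  - by move=> w _; rewrite lee_fin.
  - exact/measurable_EFinP.
(* In the extended reals this equation forces x to be finite, so finiteness of the second moments
   comes with their values. *)
have subE (x : \bar R) (b c : R) : (x + b%:E = c%:E)%E -> x = (c - b)%:E.
  by case: x => //= r; rewrite -EFinD => -[<-]; rewrite addrK.
have int1 (c : R) : (\int[P]_w c%:E)%E = c%:E.
  rewrite (integral_cst P measurableT c%:E).
  by rewrite -[RHS]mule1 -(probability_setT P).
have intcX (c : R) : 0 <= c -> (\int[P]_w (c * X w)%:E)%E = (c * m)%:E.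
  move=> c0; rewrite EFinM -iX -ge0_integralZl_EFin//.
    by move=> w _; rewrite lee_fin.
  exact/measurable_EFinP.
have mXB : measurable_fun setT (fun w => X w - m) by exact: measurable_funB.
have mcX : measurable_fun setT (fun w => 2 * m * X w) by exact: measurable_funM.
have m2X : measurable_fun setT (fun w => 2 * X w) by exact: measurable_funM.
have mBX : measurable_fun setT (fun w => 1 - X w) by exact: measurable_funB.
(* From X^2 + m^2 = (X - m)^2 + 2 m X, arranged with nonnegative terms only so that integrals
   add. *)
have iX2 : (\int[P]_w (X w ^+ 2)%:E)%E = (s + m ^+ 2)%:E.
  rewrite [LHS](_ : _ = (s + 2 * m * m - m ^+ 2)%:E); last first.
    apply: subE; rewrite -{1}[(m ^+ 2)%:E]int1 -intD//; last 3 first.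
    - exact: measurable_funX.
    - by move=> w; exact: sqr_ge0.
    - by move=> w; exact: sqr_ge0.
    rewrite EFinD -iXm -intcX; last by rewrite mulr_ge0.
    rewrite -intD//; last 3 first.
    - exact: measurable_funX.
    - by move=> w; exact: sqr_ge0.
    - by move=> w; rewrite !mulr_ge0.
    by apply: eq_integral => w _; congr EFin; ring.
  by congr EFin; ring.
split=> //.
(* From (1 - X)^2 + 2 X = 1 + X^2, again with nonnegative terms. *)
rewrite [LHS](_ : _ = (1 + (s + m ^+ 2) - 2 * m)%:E); last first.
  apply: subE; rewrite -intcX// -intD//; last 3 first.
  - exact: measurable_funX.
  - by move=> w; exact: sqr_ge0.
  - by move=> w; rewrite mulr_ge0.
  rewrite EFinD -iX2 -(int1 1) -intD//; last 2 first.
  - exact: measurable_funX.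
  - by move=> w; exact: sqr_ge0.
  by apply: eq_integral => w _; congr EFin; ring.
by congr EFin; ring.
Qed.

Section expected_energy.
Context (d : measure_display) (T : measurableType d) (R : realType).
Variables (P : probability T R) (V : nat -> nat -> {RV P >-> R}).
Variables (dlt sgm : nat -> nat -> R) (delta sigma : nat -> R).
Hypothesis V01 : forall m j, pyramid_index m j -> forall w, 0 <= V m j w <= 1.
Hypothesis Vind : mutually_independent P [set i | pyramid_index i.1 i.2]
  (fun (i : nat * nat) (w : T) => V i.1 i.2 w).
Hypothesis EV : forall m j, pyramid_index m j ->
  ('E_P[V m j] = (2^-1 + dlt m j)%:E)%E.
Hypothesis VarV : forall m j, pyramid_index m j ->
  0 <= sgm m j /\ ('V_P[V m j] = (sgm m j ^+ 2)%:E)%E.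
Hypothesis dlt_le : forall m j, pyramid_index m j -> `|dlt m j| <= delta m.
Hypothesis sgm_le : forall m j, pyramid_index m j -> sgm m j <= sigma m.

Let v w m j := V m j w.
Let v01 w m j : pyramid_index m j -> 0 <= v w m j <= 1.
Proof. by move=> mj; exact: V01. Qed.

(** The removed indices are those of level at most m; the increments of level m are built from these
    variables alone. *)
Let indep (m : nat) (Y : T -> R) :=
  indep_outside P (fun (i : nat * nat) w => V i.1 i.2 w)
    [set i | pyramid_index i.1 i.2] [set i | (i.1 <= m)%N] Y.

Lemma measurable_Qgrid m j : measurable_fun setT (fun w => Qgrid (v w) m j).
Proof.
elim: m j => [|m IH] j /=; first exact: measurable_cst.
case: (odd j); last exact: IH.
apply: measurable_funD; apply: measurable_funM => //.
exact: measurable_funB.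
Qed.

Lemma measurable_Qinc2 m j : measurable_fun setT (fun w => Qinc (v w) m j ^+ 2).
Proof.
by apply: measurable_funX; apply: measurable_funB; exact: measurable_Qgrid.
Qed.

Lemma integral_Qinc2_lty m j : (j < 2 ^ m)%N ->
  (\int[P]_w (Qinc (v w) m j ^+ 2)%:E < +oo)%E.
Proof.
move=> jm; apply: (@le_lt_trans _ _ (\int[P]_w (cst 1 w)%:E)%E).
  apply: ge0_le_integral => //.
  - by move=> w _; rewrite lee_fin sqr_ge0.
  - by apply/measurable_EFinP; exact: measurable_Qinc2.
  - by apply/measurable_EFinP; exact: measurable_cst.
  - move=> w _; rewrite lee_fin; have /andP[d0 d1] := Qinc_ge0_le1 (@v01 w) jm.
    by rewrite expr_le1.
rewrite (integral_cst P measurableT 1%E) mul1e.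
exact: le_lt_trans (probability_le1 P measurableT) (ltry 1).
Qed.

(** The index (m+1, 2j+1) lies beyond level m, hence its variable is fresh for the increment. [g]
    will be x^2 or (1 - x)^2, one for each child. *)
Lemma integral_Qinc2_mul m j (g : R -> R) : (j < 2 ^ m)%N ->
  measurable_fun setT g -> (forall x, 0 <= g x) ->
  indep m (fun w => Qinc (v w) m j ^+ 2) ->
  (\int[P]_w (Qinc (v w) m j ^+ 2 * g (V m.+1 j.*2.+1 w))%:E =
   \int[P]_w (Qinc (v w) m j ^+ 2)%:E *
   \int[P]_w (g (V m.+1 j.*2.+1 w))%:E)%E /\
  indep m.+1 (fun w => Qinc (v w) m j ^+ 2 * g (V m.+1 j.*2.+1 w)).
Proof.
move=> jm mg g0 ind.
have [|||||||||-> ind'] := @indep_outside_mul _ _ _ P _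
  (fun (i : nat * nat) w => V i.1 i.2 w) [set i | pyramid_index i.1 i.2] _
  [set i | (i.1 <= m)%N] (fun w => Qinc (v w) m j ^+ 2) (m.+1, j.*2.+1) g.
- by [].
- exact: measurable_Qinc2.
- by move=> w; exact: sqr_ge0.
- exact: integral_Qinc2_lty.
- exact: mg.
- exact: g0.
- exact: pyramid_indexS.
- by rewrite /= ltnn.
- exact: ind.
split=> //; apply: indep_outsideS ind' => i /= [->//|]; exact: leqW.
Qed.

Let measurable_sqr : measurable_fun setT (fun x : R => x ^+ 2).
Proof. exact: measurable_funX. Qed.

Let measurable_sqrB : measurable_fun setT (fun x : R => (1 - x) ^+ 2).
Proof. by apply: measurable_funX; exact: measurable_funB. Qed.

(** Induction on the level: the squared increment of a child is that of its parent times V^2 or (1 -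
    V)^2 with a fresh V. *)
Lemma indep_Qinc2 m j : (j < 2 ^ m)%N -> indep m (fun w => Qinc (v w) m j ^+ 2).
Proof.
elim: m j => [|m IH] j.
  case: j => // _; rewrite (_ : (fun w => _) = cst 1); last first.
    by apply/funext => w; rewrite /Qinc/= subr0 expr1n.
  by apply: indep_outsideS (indep_outside1 _ Vind) => // i.
rewrite -[j]odd_double_half => jm.
have {}jm : (j./2 < 2 ^ m)%N.
  rewrite -ltn_double -(mul2n (2 ^ m)) -expnS.
  by rewrite (leq_ltn_trans _ jm)// leq_addl.
have ind := IH _ jm.
case: (odd j); rewrite ?[(true + _)%N]add1n ?[(false + _)%N]add0n.
  under eq_fun do rewrite QincS_odd exprMn.
  by have [] := integral_Qinc2_mul jm measurable_sqrB (fun=> sqr_ge0 _) ind.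
under eq_fun do rewrite QincS_even exprMn.
by have [] := integral_Qinc2_mul jm measurable_sqr (fun=> sqr_ge0 _) ind.
Qed.

(** The terms linear in [dlt] coming from V^2 and (1 - V)^2 cancel, so the bias enters only through
    its square. *)
Lemma integral_Qinc2S m j : (j < 2 ^ m)%N ->
  (\int[P]_w (Qinc (v w) m.+1 j.*2 ^+ 2)%:E +
   \int[P]_w (Qinc (v w) m.+1 j.*2.+1 ^+ 2)%:E <=
   (2^-1 + 2 * sigma m.+1 ^+ 2 + 2 * delta m.+1 ^+ 2)%:E *
   \int[P]_w (Qinc (v w) m j ^+ 2)%:E)%E.
Proof.
move=> jm; have ind := indep_Qinc2 jm.
have mj := pyramid_indexS jm.
under eq_integral do rewrite QincS_even exprMn.
under [X in (_ + X <= _)%E]eq_integral do rewrite QincS_odd exprMn.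
have [-> _] := integral_Qinc2_mul jm measurable_sqr (fun=> sqr_ge0 _) ind.
have [-> _] := integral_Qinc2_mul jm measurable_sqrB (fun=> sqr_ge0 _) ind.
have int0 (f : T -> R) : (0 <= \int[P]_w (f w ^+ 2)%:E)%E.
  by apply: integral_ge0 => w _; rewrite lee_fin sqr_ge0.
have [s0 VV] := VarV mj.
rewrite -ge0_muleDr//; have [-> ->] := second_moments (V01 mj) (EV mj) VV.
rewrite muleC; apply: lee_wpmul2r => //.
rewrite -EFinD lee_fin.
have h1 : sgm m.+1 j.*2.+1 ^+ 2 <= sigma m.+1 ^+ 2.
  by rewrite ler_sqr ?nnegrE ?sgm_le// (le_trans s0)// sgm_le.
have h2 : dlt m.+1 j.*2.+1 ^+ 2 <= delta m.+1 ^+ 2.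
  rewrite -[leLHS]real_normK ?num_real// ler_sqr ?nnegrE ?dlt_le//.
  exact: le_trans (dlt_le mj).
lra.
Qed.

Lemma measurable_energy m : measurable_fun setT (fun w => energy (v w) m).
Proof.
apply: measurable_funM => //; apply: measurable_sum => j.
exact: measurable_Qinc2.
Qed.

Lemma energy_ge0 w m : 0 <= energy (v w) m.
Proof.
by rewrite mulr_ge0 ?exprn_ge0// sumr_ge0// => j _; exact: sqr_ge0.
Qed.

Lemma integral_energyE m : (\int[P]_w (energy (v w) m)%:E =
  (2 ^+ m)%:E * \sum_(j < 2 ^ m) \int[P]_w (Qinc (v w) m j ^+ 2)%:E)%E.
Proof.
under eq_integral do rewrite /energy EFinM -sumEFin.
rewrite ge0_integralZl//.
- rewrite ge0_integral_sum//.
  + by move=> j; apply/measurable_EFinP; exact: measurable_Qinc2.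
  + by move=> j w _; rewrite lee_fin sqr_ge0.
- apply: emeasurable_sum => j.
  by apply/measurable_EFinP; exact: measurable_Qinc2.
- by move=> w _; apply: sume_ge0 => j _; rewrite lee_fin sqr_ge0.
Qed.

Lemma integral_energyS m : (\int[P]_w (energy (v w) m.+1)%:E <=
  (1 + 4 * (sigma m.+1 ^+ 2 + delta m.+1 ^+ 2))%:E *
  \int[P]_w (energy (v w) m)%:E)%E.
Proof.
rewrite !integral_energyE.
rewrite (sum_pow2S m (fun i => \int[P]_w (Qinc (v w) m.+1 i ^+ 2)%:E)%E).
rewrite [leRHS]muleA -EFinM.
apply: (@le_trans _ _ ((2 ^+ m.+1)%:E * \sum_(j < 2 ^ m)
    ((2^-1 + 2 * sigma m.+1 ^+ 2 + 2 * delta m.+1 ^+ 2)%:E *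
    \int[P]_w (Qinc (v w) m j ^+ 2)%:E))%E).
  apply: lee_wpmul2l; first by rewrite lee_fin exprn_ge0.
  by apply: lee_sum => j _; exact: integral_Qinc2S.
rewrite -ge0_sume_distrr; last first.
  by move=> j _; apply: integral_ge0 => w _; rewrite lee_fin sqr_ge0.
(* With a = sigma^2 + delta^2, 2^(m+1) (1/2 + 2a) = 2^m (1 + 4a). *)
rewrite muleA -EFinM le_eqVlt; apply/orP; left; apply/eqP; congr (_%:E * _)%E.
by rewrite exprS; field.
Qed.

(** The inequality 1 + x <= exp x turns the product of the one-level factors into the exponential of
    a sum. *)
Lemma integral_energy_le (A : R) :
  (forall n, \sum_(1 <= k < n.+1) (sigma k ^+ 2 + delta k ^+ 2) <= A) ->
  forall m, (\int[P]_w (energy (v w) m)%:E <= (expR (4 * A))%:E)%E.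
Proof.
move=> hA m.
(* The induction runs with the exact exponent up to level m, which is bounded through [A]
   separately. *)
pose e n := 4 * \sum_(1 <= k < n.+1) (sigma k ^+ 2 + delta k ^+ 2).
apply: (@le_trans _ _ (expR (e m))%:E); last first.
  by rewrite lee_fin ler_expR ler_wpM2l.
elim: m => [|m IH].
  rewrite /e big_geq// mulr0 expR0.
  rewrite (_ : (fun w => _) = cst 1%E); last first.
    apply/funext => w.
    by rewrite /energy big_ord1 expr0 /Qinc/= subr0 expr1n mulr1.
  rewrite (integral_cst P measurableT 1%E) mul1e.
  exact: probability_le1.
apply: le_trans (integral_energyS m) _.
rewrite /e big_nat_recr//= [X in expR X]mulrDr expRD EFinM [leRHS]muleC.
apply: lee_pmul => //.
- by rewrite lee_fin addr_ge0// mulr_ge0// addr_ge0// sqr_ge0.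
- by apply: integral_ge0 => w _; rewrite lee_fin energy_ge0.
- by rewrite lee_fin expR_ge1Dx.
Qed.

(** By monotone convergence the limit of the energies is integrable, hence almost surely finite, and
    it dominates each of them. *)
Lemma energy_ae_bounded (A : R) :
  (forall n, \sum_(1 <= k < n.+1) (sigma k ^+ 2 + delta k ^+ 2) <= A) ->
  {ae P, forall w, exists B, forall m, energy (v w) m <= B}.
Proof.
move=> /integral_energy_le hA.
pose S w := limn (fun m => (energy (v w) m)%:E).
have nd w : {homo (fun m => (energy (v w) m)%:E) :
    m n / (m <= n)%N >-> (m <= n)%E}.
  by move=> m n mn; rewrite lee_fin energy_homo.
have mE m : measurable_fun setT (fun w => (energy (v w) m)%:E).
  by apply/measurable_EFinP; exact: measurable_energy.
have le_S w m : ((energy (v w) m)%:E <= S w)%E.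
  apply: lime_ge; first exact: ereal_nondecreasing_is_cvgn.
  by exists m => // n mn; exact: nd.
have S0 w : (0 <= S w)%E.
  by apply: le_trans (le_S w 0%N); rewrite lee_fin energy_ge0.
have mS : measurable_fun setT S.
  by apply: emeasurable_fun_cvg mE _ => w _; exact: ereal_nondecreasing_is_cvgn.
have iS : P.-integrable setT S.
  apply/integrableP; split=> //.
  under eq_integral do rewrite gee0_abs//.
  rewrite monotone_convergence//; last first.
  - by move=> m w _; rewrite lee_fin energy_ge0.
  apply: (@le_lt_trans _ _ (expR (4 * A))%:E); last exact: ltry.
  apply: lime_le; last by apply: nearW => m; exact: hA.
  apply: ereal_nondecreasing_is_cvgn => m n mn; apply: ge0_le_integral => //.
  - by move=> w _; rewrite lee_fin energy_ge0.
  - by move=> w _; exact: nd.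
apply: filterS (integrable_ae measurableT iS) => w Sw.
by exists (fine (S w)) => m; rewrite -lee_fin fineK ?Sw.
Qed.

End expected_energy.

(** * Summability of the bounds and conclusion *)

Lemma partial_sums_bounded (R : realType) (u : nat -> R) (N : nat) :
  (forall k, (N <= k)%N -> 0 <= u k) -> (\sum_(N <= k <oo) (u k)%:E < +oo)%E ->
  exists A, forall n, \sum_(N <= k < n) u k <= A.
Proof.
move=> u0 uoo; have u0E k : (N <= k)%N -> true -> (0 <= (u k)%:E)%E.
  by move=> Nk _; rewrite lee_fin u0.
exists (fine (\sum_(N <= k <oo) (u k)%:E)%E) => n.
rewrite -lee_fin fineK ?ge0_fin_numE ?nneseries_ge0// -sumEFin.
exact: nneseries_lim_ge.
Qed.

Theorem proposition2p3 (d : measure_display) (T : measurableType d)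
    (R : realType) (P : probability T R) (V : nat -> nat -> {RV P >-> R})
    (dlt sgm : nat -> nat -> R) (delta sigma : nat -> R)
    (hV01 : forall m j, pyramid_index m j -> forall w, 0 <= V m j w <= 1)
    (hVind : mutually_independent P [set i | pyramid_index i.1 i.2]
               (fun (i : nat * nat) (w : T) => V i.1 i.2 w))
    (hE : forall m j, pyramid_index m j ->
            ('E_P[V m j] = (2^-1 + dlt m j)%:E)%E)
    (hVar : forall m j, pyramid_index m j ->
              0 <= sgm m j /\ ('V_P[V m j] = (sgm m j ^+ 2)%:E)%E)
    (hdlt : forall m j, pyramid_index m j -> `|dlt m j| <= delta m)
    (hsgm : forall m j, pyramid_index m j -> sgm m j <= sigma m)
    (hsum_sigma : (\sum_(1 <= m <oo) (sigma m ^+ 2)%:E < +oo)%E)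
    (hsum_delta : (\sum_(1 <= m <oo) (delta m)%:E < +oo)%E) :
  {ae P, forall w : T,
    exists q : R -> R,
      [/\ (@lebesgue_measure R).-integrable `[0, 1] (EFin \o q),
          {ae @lebesgue_measure R, forall y : R, 0 <= y <= 1 ->
             qlevel (fun m j => V m j w) m y @[m --> \oo] --> q y} &
          forall y : R, 0 <= y <= 1 ->
             Qlevel (fun m j => V m j w) m y @[m --> \oo]
               --> Qlimit (fun m j => V m j w) y /\
             Qlimit (fun m j => V m j w) y =
               \int[@lebesgue_measure R]_(u in `[0, y]) q u]}.
Proof.
(* Every level k >= 1 contains the index (k, 1), so [delta k] dominates an absolute value and is
   nonnegative. *)
have idx1 k : (1 <= k)%N -> pyramid_index k 1.
  by case: k => // k _; rewrite /pyramid_index /= -{1}(expn0 2) ltn_exp2l.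
have delta0 k : (1 <= k)%N -> 0 <= delta k.
  by move=> /idx1 /hdlt; exact: le_trans.
have [A1 hA1] := partial_sums_bounded (fun k _ => sqr_ge0 (sigma k)) hsum_sigma.
have [A2 hA2] := partial_sums_bounded delta0 hsum_delta.
have A20 : 0 <= A2 by have := hA2 1%N; rewrite big_geq.
(* Each term is at most the bound [A2] on the partial sums, so delta^2 <= A2 delta and the squares
   are summable too. *)
have delta_le k : (1 <= k)%N -> delta k <= A2.
  move=> k1; apply: le_trans (hA2 k.+1); rewrite big_nat_recr//= lerDr.
  by rewrite big_nat_cond sumr_ge0// => i /andP[/andP[i1 _] _]; exact: delta0.
have hA n : \sum_(1 <= k < n.+1) (sigma k ^+ 2 + delta k ^+ 2) <= A1 + A2 * A2.
  rewrite big_split/= lerD//.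
  apply: (@le_trans _ _ (\sum_(1 <= k < n.+1) A2 * delta k)).
    rewrite !big_nat; apply: ler_sum => k /andP[k1 _].
    by rewrite expr2 ler_wpM2r ?delta0 ?delta_le.
  by rewrite -mulr_sumr ler_wpM2l.
have := energy_ae_bounded hV01 hVind hE hVar hdlt hsgm hA.
apply: filterS => w [B hB].
by apply: density_of_bounded_energy hB => m j mj; exact: hV01.
Qed.
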